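(* Let $E: y^2=x^3+ax^2+bx+c$ ($a,b,c\in\mathbb{Z}$) be an elliptic curve, $P\in E(\mathbb{Q})$ a point of infinite order, $k\ge1$, and $p$ an odd prime with $p\mid\tau_k$. Then $2^{k-1}P$ reduces modulo $p$ to a singular point of the reduced curve, and $n_{k-1}\equiv 0\pmod p$ (i.e. the numerator of $Y(2^{k-1}P)$ is divisible by $p$).
   Context: An elliptic curve is a non-singular cubic $y^2=x^3+ax^2+bx+c$ with $a,b,c\in\mathbb{Z}$, projectively $y^2z=x^3+ax^2z+bxz^2+cz^3$. For $k\ge0$ write $2^kP=\left(\frac{m_k}{e_k^2},\frac{n_k}{e_k^3}\right)$ with $m_k,n_k,e_k\in\mathbb{Z}$, $e_k\ge1$, $\gcd(m_k,e_k)=\gcd(n_k,e_k)=1$. Define $F_0(E,P)=e_0$, $F_k(E,P)=e_k/e_{k-1}$ and $\tau_k=\frac{2n_{k-1}}{F_k(E,P)}\in\mathbb{Z}$ for $k\ge1$. A point $\left(\frac{m}{e^2},\frac{n}{e^3}\right)$ reduces mod $p$ to $(me\bmod p:n\bmod p:e^3\bmod p)$ on the curve $y^2z=x^3+ax^2z+bxz^2+cz^3$ over $\mathbb{F}_p$; a singular point is one where this cubic form and all its partial derivatives vanish. *)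

(* Defs.v *)
From HB Require Import structures.
From mathcomp Require Export all_boot all_order all_algebra all_field.

Set Implicit Arguments.
Unset Strict Implicit.
Unset Printing Implicit Defensive.

Import Order.TTheory GRing.Theory Num.Theory.
Local Open Scope ring_scope.

Definition cubic_form (a b c : int) (R : comNzRingType) (x y z : R) : R :=
  y ^+ 2 * z
  - (x ^+ 3 + a%:~R * x ^+ 2 * z + b%:~R * x * z ^+ 2 + c%:~R * z ^+ 3).

(* Partial derivatives: freeze the other two coordinates as constant
   polynomials, take the formal derivative, and evaluate. *)
Definition cubic_dx (a b c : int) (R : comNzRingType) (x y z : R) : R :=
  ((cubic_form a b c 'X y%:P z%:P)^`()).[x].
Definition cubic_dy (a b c : int) (R : comNzRingType) (x y z : R) : R :=
  ((cubic_form a b c x%:P 'X z%:P)^`()).[y].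
Definition cubic_dz (a b c : int) (R : comNzRingType) (x y z : R) : R :=
  ((cubic_form a b c x%:P y%:P 'X)^`()).[z].

(* (x : y : z) is given by homogeneous coordinates, hence not all zero; the
   condition does not depend on the choice of representative. *)
Definition singular_point (a b c : int) (K : fieldType) (x y z : K) : Prop :=
  [/\ (x, y, z) <> (0, 0, 0), cubic_form a b c x y z = 0,
      cubic_dx a b c x y z = 0, cubic_dy a b c x y z = 0
    & cubic_dz a b c x y z = 0].

(* Non-singularity is geometric: no singular point over the algebraic closure
   of the rationals. *)
Definition elliptic_curve (a b c : int) : Prop :=
  forall x y z : algC, ~ singular_point a b c x y z.

Inductive point : Type := Infinity | Affine of rat & rat.

Definition on_curve (a b c : int) (P : point) : Prop :=
  if P is Affine x y then
    y ^+ 2 = x ^+ 3 + a%:~R * x ^+ 2 + b%:~R * x + c%:~R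
  else True.

(* Chord-and-tangent law. On the curve, if x1 = x2 and y1 <> - y2 then the two
   points coincide and y1 <> 0, so the slope is that of the tangent. *)
Definition add_point (a b : int) (P Q : point) : point :=
  match P, Q with
  | Infinity, _ => Q
  | _, Infinity => P
  | Affine x1 y1, Affine x2 y2 =>
    if (x1 == x2) && (y1 == - y2) then Infinity else
    let l := if x1 == x2
             then (3 * x1 ^+ 2 + 2 * a%:~R * x1 + b%:~R) / (2 * y1)
             else (y2 - y1) / (x2 - x1) in
    let x3 := l ^+ 2 - a%:~R - x1 - x2 in
    Affine x3 (l * (x1 - x3) - y1)
  end.

Definition mul_point (a b : int) (n : nat) (P : point) : point :=
  iter n (add_point a b P) Infinity.

Definition infinite_order (a b : int) (P : point) : Prop :=
  forall n : nat, (0 < n)%N -> mul_point a b n P <> Infinity.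

(* 2^k P, by k successive doublings *)
Definition dbl_point (a b : int) (k : nat) (P : point) : point :=
  iter k (fun Q => add_point a b Q Q) P.

(* The sequences m, n, e are determined by P, because e k >= 1 and the
   fractions are in lowest terms. *)
Definition doubling_coords (a b : int) (P : point) (m n e : nat -> int) : Prop :=
  forall k : nat,
    [/\ 1 <= e k, coprimez (m k) (e k), coprimez (n k) (e k)
      & dbl_point a b k P =
        Affine ((m k)%:~R / (e k)%:~R ^+ 2) ((n k)%:~R / (e k)%:~R ^+ 3)].

Definition fermat_number (e : nat -> int) (k : nat) : rat :=
  if k is j.+1 then (e j.+1)%:~R / (e j)%:~R else (e 0%N)%:~R.

(* Meaningful for k >= 1 only. *)
Definition tau (n e : nat -> int) (k : nat) : rat :=
  2 * (n k.-1)%:~R / fermat_number e k.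

(* Main.v *)
(** Write Q = 2^(k-1) P = (M/E^2, N/E^3), let f be the cubic, and put
    A = 3 M^2 + 2 a M E^2 + b E^4, so that the tangent slope at Q is A / (2NE).
    Since 2NE = tau_k e_k, clearing denominators in the duplication formula gives
    m_k tau_k^2 = A^2 - 4 N^2 (a E^2 + 2 M).  If p divides tau_k, then p divides
    NE.  Were p to divide E, the formula would reduce to 0 = 9 M^4 - 8 M^4 modulo
    p, contradicting gcd(M, E) = 1.  So p divides N, hence A: the reduction of Q
    is an affine point with y = 0 and f'(x) = 0. *)

Require Import Defs.
From mathcomp Require Import all_boot all_order all_algebra all_field.
From mathcomp Require Import ring.
Set Implicit Arguments.
Unset Strict Implicit.

Import Order.TTheory GRing.Theory Num.Theory.
Local Open Scope ring_scope.

Lemma cubic_dxE (a b c : int) (R : comNzRingType) (x y z : R) :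
  cubic_dx a b c x y z = - (3 * x ^+ 2 + 2 * a%:~R * x * z + b%:~R * z ^+ 2).
Proof.
rewrite /cubic_dx /cubic_form -!polyCMz -!polyC_exp !(derivE, hornerE) /=.
ring.
Qed.

Lemma cubic_dyE (a b c : int) (R : comNzRingType) (x y z : R) :
  cubic_dy a b c x y z = 2 * y * z.
Proof.
rewrite /cubic_dy /cubic_form -!polyCMz -!polyC_exp !(derivE, hornerE) /=.
ring.
Qed.

Lemma cubic_dzE (a b c : int) (R : comNzRingType) (x y z : R) :
  cubic_dz a b c x y z
  = y ^+ 2 - (a%:~R * x ^+ 2 + 2 * b%:~R * x * z + 3 * c%:~R * z ^+ 2).
Proof.
rewrite /cubic_dz /cubic_form -!polyCMz -!polyC_exp !(derivE, hornerE) /=.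
ring.
Qed.

Lemma Affine_inj (x y x' y' : rat) :
  Affine x y = Affine x' y' -> x = x' /\ y = y'.
Proof. by case. Qed.

(** In a doubling, the test for opposite points becomes y = -y, which in characteristic 0 singles
    out the points of order 2. *)
Lemma eq_oppr_rat (y : rat) : (y == - y) = (y == 0).
Proof. by rewrite -subr_eq0 opprK -mulr2n mulrn_eq0. Qed.

Lemma double_affine (a b : int) (x y : rat) : y != 0 ->
  let l := (3 * x ^+ 2 + 2 * a%:~R * x + b%:~R) / (2 * y) in
  let x3 := l ^+ 2 - a%:~R - x - x in
  add_point a b (Affine x y) (Affine x y) = Affine x3 (l * (x - x3) - y).
Proof. by move=> y0; rewrite /= eqxx eq_oppr_rat (negPf y0). Qed.

Lemma double_order2 (a b : int) (x : rat) :
  add_point a b (Affine x 0) (Affine x 0) = Infinity.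
Proof. by rewrite /= oppr0 !eqxx. Qed.

Lemma on_curve_double (a b c : int) (Q : point) :
  on_curve a b c Q -> on_curve a b c (add_point a b Q Q).
Proof.
case: Q => [//|x y] Hxy.
have [->|y0] := eqVneq y 0; first by rewrite double_order2.
rewrite double_affine //=.
set l := _ / _.
have Hl : 2 * y * l = 3 * x ^+ 2 + 2 * a%:~R * x + b%:~R.
  by rewrite /l mulrC divfK // mulf_neq0.
(* From here only the relation [Hl] on the slope matters, so the identity to check is polynomial. *)
move: l Hl => l Hl; rewrite /= in Hxy.
set x3 := _ - x - x; set y3 := _ - y.
(* The tangent line meets the curve at abscissas x, x, x3. *)
apply/eqP; rewrite -subr_eq0; apply/eqP.
transitivity ((y ^+ 2 - (x ^+ 3 + a%:~R * x ^+ 2 + b%:~R * x + c%:~R))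
  + (2 * y * l - (3 * x ^+ 2 + 2 * a%:~R * x + b%:~R)) * (x3 - x)).
  by rewrite /y3 /x3; ring.
by rewrite Hxy Hl !subrr mul0r addr0.
Qed.

Lemma on_curve_dbl_point (a b c : int) (k : nat) (P : point) :
  on_curve a b c P -> on_curve a b c (dbl_point a b k P).
Proof. by move=> HP; elim: k => //= k; apply: on_curve_double. Qed.

Lemma on_curve_integral (a b c M N E : int) : E != 0 ->
  on_curve a b c (Affine (M%:~R / E%:~R ^+ 2) (N%:~R / E%:~R ^+ 3)) ->
  N ^+ 2 = M ^+ 3 + a * M ^+ 2 * E ^+ 2 + b * M * E ^+ 4 + c * E ^+ 6.
Proof.
move=> E0 /= H; apply: (intr_inj (R := rat)).
have E0' : E%:~R != 0 :> rat by rewrite intr_eq0.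
have -> : ((N ^+ 2)%:~R : rat) = (N%:~R / E%:~R ^+ 3) ^+ 2 * E%:~R ^+ 6 by field.
by rewrite H; field.
Qed.

Lemma duplication_integral (a b M N E M' E' t : int) (y' : rat) :
  E != 0 -> E' != 0 -> 2 * N * E = t * E' ->
  add_point a b (Affine (M%:~R / E%:~R ^+ 2) (N%:~R / E%:~R ^+ 3))
                (Affine (M%:~R / E%:~R ^+ 2) (N%:~R / E%:~R ^+ 3))
    = Affine (M'%:~R / E'%:~R ^+ 2) y' ->
  M' * t ^+ 2 = (3 * M ^+ 2 + 2 * a * M * E ^+ 2 + b * E ^+ 4) ^+ 2
                - 4 * N ^+ 2 * (a * E ^+ 2 + 2 * M).
Proof.
move=> E0 E0' Ht.
have e0 : E%:~R != 0 :> rat by rewrite intr_eq0.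
have e0' : E'%:~R != 0 :> rat by rewrite intr_eq0.
(* If N = 0, the double is [Infinity], whereas it is assumed affine. *)
have [->|N0] := eqVneq N 0; first by rewrite mul0r double_order2.
have n0 : N%:~R != 0 :> rat by rewrite intr_eq0.
rewrite double_affine; last by rewrite mulf_neq0 // invr_eq0 expf_neq0.
case/Affine_inj => Hx _; apply: (intr_inj (R := rat)).
have Ht' : 2 * N%:~R * E%:~R = t%:~R * E'%:~R :> rat.
  by move/(congr1 (intr : int -> rat)): Ht; rewrite !rmorphM.
have -> : ((M' * t ^+ 2)%:~R : rat) = M'%:~R / E'%:~R ^+ 2 * (t%:~R * E'%:~R) ^+ 2 by field.
by rewrite -Ht' -Hx; field; rewrite e0 n0.
Qed.

(** A Bezout relation maps to K; if x and y both vanished there, it would read 0 = 1. *)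
Lemma coprimez_intr_neq0 (K : fieldType) (x y : int) :
  coprimez x y -> y%:~R = 0 :> K -> x%:~R != 0 :> K.
Proof.
case/coprimezP => -[u v] /= /(congr1 (intr : int -> K)).
rewrite rmorphD !rmorphM /= => H y0; apply/eqP => x0.
by move/eqP: H; rewrite x0 y0 !mulr0 addr0 eq_sym oner_eq0.
Qed.

Section Reduction.

Variables (K : fieldType) (a b c M N E M' t : int).
Hypotheses (coME : coprimez M E)
  (curveQ : N ^+ 2 = M ^+ 3 + a * M ^+ 2 * E ^+ 2 + b * M * E ^+ 4 + c * E ^+ 6)
  (dupQ : M' * t ^+ 2 = (3 * M ^+ 2 + 2 * a * M * E ^+ 2 + b * E ^+ 4) ^+ 2
                        - 4 * N ^+ 2 * (a * E ^+ 2 + 2 * M))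
  (t0 : t%:~R = 0 :> K).

Let curveK : (N%:~R : K) ^+ 2 = M%:~R ^+ 3 + a%:~R * M%:~R ^+ 2 * E%:~R ^+ 2
  + b%:~R * M%:~R * E%:~R ^+ 4 + c%:~R * E%:~R ^+ 6.
Proof. by rewrite -rmorphXn curveQ; ring. Qed.

Let dupK : (0 : K) =
  (3 * M%:~R ^+ 2 + 2 * a%:~R * M%:~R * E%:~R ^+ 2 + b%:~R * E%:~R ^+ 4) ^+ 2
  - 4 * N%:~R ^+ 2 * (a%:~R * E%:~R ^+ 2 + 2 * M%:~R).
Proof.
transitivity ((M' * t ^+ 2)%:~R : K); last by rewrite dupQ; ring.
by rewrite rmorphM rmorphXn /= t0 expr0n mulr0.
Qed.

Lemma den_neq0 : E%:~R != 0 :> K.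
Proof.
apply/eqP => E0; have /eqP := coprimez_intr_neq0 coME E0; case.
move: dupK; rewrite curveK E0.
(* Once E = 0, the curve equation has turned N^2 into M^3, so the duplication formula reads 0 =
   (3x^2)^2 - 4x^3 * 2x = x^4. *)
set x := M%:~R => H; have : x ^+ 4 = 0 by rewrite H; ring.
by move/eqP; rewrite expf_eq0 /= => /eqP.
Qed.

(** With N = 0, the curve equation and the duplication formula make the expressions in [F0] and [A0]
    vanish. At (ME : 0 : E^3) the cubic form is -E^3 times the first, and its x-derivative is -E^2
    times the second. *)
Lemma singular_reduction : N%:~R = 0 :> K ->
  singular_point a b c ((M * E)%:~R : K) (N%:~R : K) ((E ^+ 3)%:~R : K).
Proof.
move=> N0; have E0 := den_neq0.
have A0 : 3 * M%:~R ^+ 2 + 2 * a%:~R * M%:~R * E%:~R ^+ 2 + b%:~R * E%:~R ^+ 4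
          = 0 :> K.
  apply/eqP; rewrite -sqrf_eq0; apply/eqP.
  by rewrite [RHS]dupK N0; ring.
have F0 : M%:~R ^+ 3 + a%:~R * M%:~R ^+ 2 * E%:~R ^+ 2
  + b%:~R * M%:~R * E%:~R ^+ 4 + c%:~R * E%:~R ^+ 6 = 0 :> K.
  by rewrite -curveK N0 expr0n.
rewrite /singular_point cubic_dxE cubic_dyE cubic_dzE /cubic_form N0.
rewrite !(rmorphXn, rmorphM) /=; split.
- by case=> _ /eqP; rewrite expf_eq0 (negPf E0).
- by rewrite -[RHS](mulr0 (- E%:~R ^+ 3)) -[in RHS]F0; ring.
- by rewrite -[RHS](mulr0 (- E%:~R ^+ 2)) -[in RHS]A0; ring.
- by ring.
(* Euler's relation 3 F = x F_x + y F_y + z F_z. *)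
- apply: (mulfI (expf_neq0 3 E0)); rewrite mulr0.
  transitivity (- 3 * E%:~R ^+ 3 * (M%:~R ^+ 3 + a%:~R * M%:~R ^+ 2 * E%:~R ^+ 2
      + b%:~R * M%:~R * E%:~R ^+ 4 + c%:~R * E%:~R ^+ 6)
    + M%:~R * E%:~R ^+ 3 * (3 * M%:~R ^+ 2 + 2 * a%:~R * M%:~R * E%:~R ^+ 2
      + b%:~R * E%:~R ^+ 4) : K); first ring.
  by rewrite F0 A0 !mulr0 addr0.
Qed.

End Reduction.

Theorem theorem5p5 (a b c : int) (hE : elliptic_curve a b c)
    (P : point) (hP : on_curve a b c P) (hPinf : infinite_order a b P)
    (m n e : nat -> int) (hmne : doubling_coords a b P m n e)
    (k : nat) (hk : (1 <= k)%N)
    (p : nat) (hp : prime p) (hpodd : odd p)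
    (hptau : exists t : int, tau n e k = t%:~R /\ (p%:Z %| t)%Z) :
  singular_point a b c
    ((m k.-1 * e k.-1)%:~R : 'F_p) ((n k.-1)%:~R : 'F_p) ((e k.-1 ^+ 3)%:~R : 'F_p)
  /\ (n k.-1 = 0 %[mod p%:Z])%Z.
Proof.
(* With k = j + 1, the point Q is 2^j P and [t] is the integer tau_k. *)
case: k hk hptau => // j _ [t []]; rewrite /tau /= => Ht pt.
have [e1 cme _ HQ] := hmne j; have [e1' _ _ H2Q] := hmne j.+1.
have e0 : e j != 0 by rewrite gt_eqF // (lt_le_trans _ e1).
have e0' : e j.+1 != 0 by rewrite gt_eqF // (lt_le_trans _ e1').
have r0 : (e j)%:~R != 0 :> rat by rewrite intr_eq0.
have r0' : (e j.+1)%:~R != 0 :> rat by rewrite intr_eq0.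
have Ht' : 2 * n j * e j = t * e j.+1.
  apply: (intr_inj (R := rat)); rewrite !rmorphM /= -Ht.
  by field; rewrite r0 r0'.
have curveQ := on_curve_dbl_point j hP; rewrite HQ in curveQ.
have {}curveQ := on_curve_integral e0 curveQ.
(* One unfolding of the iteration exhibits 2^(j+1) P as the double of Q. *)
move: H2Q; rewrite /dbl_point /= -/(dbl_point a b j P) HQ => H2Q.
have dupQ := duplication_integral e0 e0' Ht' H2Q.
have pF := pchar_Fp hp.
have two0 : 2 != 0 :> 'F_p.
  rewrite -(dvdn_pcharf pF); apply/negP => /(dvdn_leq (isT : 0 < 2)%N).
  by move: (prime_gt1 hp) hpodd; case: (p) => [|[|[|]]].
have t0 : t%:~R = 0 :> 'F_p by apply/eqP; rewrite -(dvdz_pcharf pF).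
have E0 := den_neq0 cme curveQ dupQ t0.
(* Modulo p, 2NE = t e_k = 0, while 2 is invertible because p is odd and E by [den_neq0]. *)
have n0 : (n j)%:~R = 0 :> 'F_p.
  move/(congr1 (intr : int -> 'F_p)): Ht'; rewrite !rmorphM /= t0 mul0r.
  by move/eqP; rewrite !mulf_eq0 (negPf two0) (negPf E0) orbF => /eqP.
split; first exact: (singular_reduction cme curveQ dupQ t0).
by move/eqP: n0; rewrite -(dvdz_pcharf pF) mod0z => /dvdz_mod0P.
Qed.
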